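(* Let $\mathfrak{A}$ be a unital Banach algebra with a set of $n\times n$ partial matrix units $P_i,U_i,V_i$, and let $\mathfrak{A}_1=P_1\mathfrak{A}P_1$. Then $\mathrm{rtsr}(\mathfrak{A}_1)\le(\mathrm{rtsr}(\mathfrak{A})-1)n+1$ and hence $$\left\lceil\frac{\mathrm{rtsr}(\mathfrak{A}_1)-1}{n}\right\rceil+1\le\mathrm{rtsr}(\mathfrak{A}).$$ Suppose that $E_i=P_1$ for $1\le i\le m$. If $\mathfrak{A}_1$ is completely finite, then $$\mathrm{rtsr}(\mathfrak{A})\le\left\lceil\frac{\mathrm{rtsr}(\mathfrak{A}_1)-1}{m}\right\rceil+1.$$
   Context: A set of $n\times n$ partial matrix units in a unital Banach algebra $\mathfrak{A}$ is a collection of pairwise orthogonal idempotents $P_i\in\mathfrak{A}$, $1\le i\le n$, with $\sum_{i=1}^nP_i=I$, together with elements $U_i,V_i\in\mathfrak{A}$ for $2\le i\le n$ satisfying $U_i=P_iU_iP_1$, $V_i=P_1V_iP_i$ and $U_iV_i=P_i$ for $2\le i\le n$ (it is not required that $V_iU_i=P_1$). Put $E_i=V_iU_i$ for $2\le i\le n$, an idempotent with $E_i=E_iP_1=P_1E_i$, and $E_1=P_1$. $\mathfrak{A}_1=P_1\mathfrak{A}P_1$ is regarded as a Banach algebra with unit $P_1$. Here $1\le m\le n$. For a unital Banach algebra $\mathfrak{B}$, $\mathrm{rtsr}(\mathfrak{B})$ (right topological stable rank) is the least positive integer $k$ such that the set of $(a_1,\dots,a_k)\in\mathfrak{B}^k$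 for which there is $(b_1,\dots,b_k)\in\mathfrak{B}^k$ with $\sum_{i=1}^k a_ib_i=1$ is dense in $\mathfrak{B}^k$; it is $\infty$ if no such $k$ exists (expressions above equal $\infty$ when the rank in them is $\infty$). $\mathfrak{B}$ is completely finite if for all $k\ge1$ every right invertible $1\times k$ row $R$ over $\mathfrak{B}$ (i.e. $RC=1$ for some $k\times1$ column $C$ over $\mathfrak{B}$) is the first row of an invertible matrix in $\mathfrak{M}_k(\mathfrak{B})$. *)

(* Defs.v *)
From HB Require Import structures.
From mathcomp Require Import all_boot all_order all_algebra archimedean.
From mathcomp Require Import complex.
From mathcomp Require Import all_classical all_reals ereal topology normedtype.

Set Implicit Arguments.
Unset Strict Implicit.
Unset Printing Implicit Defensive.

Import Order.TTheory GRing.Theory Num.Theory.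
Import numFieldNormedType.Exports.

Local Open Scope classical_set_scope.
Local Open Scope ring_scope.

(** Scalars range over an [archiNumFieldType]: this covers both [R : realType]
    and, by the following instance, [R[i]]. *)
Section ComplexArchimedean.
Variable R : realType.

Lemma complex_archimedean : Num.archimedean_axiom R[i].
Proof.
move=> z.
have zR : `|z| = (complex.Re `|z|)%:C%C.
  have : `|z| \is Num.real by exact: normr_real.
  by move=> /RRe_real ->.
exists (Num.bound (complex.Re `|z|)).
have h : complex.Re `|z| < (Num.bound (complex.Re `|z|))%:R.
  apply: archi_boundP; have := normr_ge0 z.
  by rewrite [X in _ <= X]zR lecE /= => /andP[].
by rewrite zR -(rmorph_nat (real_complex R)) ltcR.
Qed.

HB.instance Definition _ :=
  Num.NumDomain_bounded_isArchimedean.Build R[i] complex_archimedean.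
End ComplexArchimedean.

(** Not an HB structure: a join of rings and normed modules cannot be declared
    above [Num.NumDomain]. The norm of the unit is not required to be 1, since
    the norm of an idempotent [p], the unit of the corner [p A p], need not be. *)
Record banachAlgType (K : numFieldType) := BanachAlg {
  ba_space : completeNormedModType K ;
  ba_one : ba_space ;
  ba_mul : ba_space -> ba_space -> ba_space ;
  ba_mulA : associative ba_mul ;
  ba_mul1r : left_id ba_one ba_mul ;
  ba_mulr1 : right_id ba_one ba_mul ;
  ba_mulDl : left_distributive ba_mul +%R ;
  ba_mulDr : right_distributive ba_mul +%R ;
  ba_scaleAl : forall (a : K) x y, a *: ba_mul x y = ba_mul (a *: x) y ;
  ba_scaleAr : forall (a : K) x y, a *: ba_mul x y = ba_mul x (a *: y) ;
  ba_one_neq0 : ba_one != 0 ;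
  ba_normM : forall x y, `|ba_mul x y| <= `|x| * `|y| }.

Definition ba_sort (K : numFieldType) (A : banachAlgType K) : Type :=
  ba_space A.
Coercion ba_sort : banachAlgType >-> Sortclass.

Section BanachAlgebraInstances.
Variables (K : numFieldType) (A : banachAlgType K).

HB.instance Definition _ := CompleteNormedModule.on (ba_sort A).
HB.instance Definition _ := GRing.Zmodule_isNzRing.Build (ba_sort A)
  (@ba_mulA K A) (@ba_mul1r K A) (@ba_mulr1 K A) (@ba_mulDl K A)
  (@ba_mulDr K A) (@ba_one_neq0 K A).
HB.instance Definition _ := GRing.Lmodule_isLalgebra.Build K (ba_sort A)
  (@ba_scaleAl K A).
HB.instance Definition _ := GRing.Lalgebra_isAlgebra.Build K (ba_sort A)
  (@ba_scaleAr K A).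

Lemma ler_normrM (x y : A) : `|x * y| <= `|x| * `|y|.
Proof. exact: ba_normM. Qed.

End BanachAlgebraInstances.

Section CornerSpace.
Variables (K : numFieldType) (A : banachAlgType K) (p : A).

Definition corner_pred : {pred A} := [pred x | p * x * p == x].

Lemma cornerP (x : A) : p * p = p ->
  reflect (exists a, x = p * a * p) (x \in corner_pred).
Proof.
move=> pp; rewrite inE; apply: (iffP eqP) => [<-|[a ->]]; first by exists x.
by rewrite !mulrA pp -mulrA pp.
Qed.

Lemma corner_submod : submod_closed corner_pred.
Proof.
split=> [|a x y]; rewrite !inE ?mulr0 ?mul0r // => /eqP hx /eqP hy.
by rewrite mulrDr mulrDl -scalerAr -scalerAl hx hy.
Qed.

HB.instance Definition _ := GRing.isSubmodClosed.Build K A corner_pred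
  corner_submod.

Record corner : Type := Corner {
  corner_val :> A ;
  corner_valP : corner_val \in corner_pred }.

HB.instance Definition _ := [isSub for corner_val].
HB.instance Definition _ := [Choice of corner by <:].
HB.instance Definition _ := [SubChoice_isSubLmodule of corner by <:].

Definition corner_norm (x : corner) : K := `|val x|.

Lemma corner_ler_normD x y :
  corner_norm (x + y) <= corner_norm x + corner_norm y.
Proof. exact: ler_normD. Qed.

Lemma corner_normrZ (l : K) x : corner_norm (l *: x) = `|l| * corner_norm x.
Proof. exact: normrZ. Qed.

Lemma corner_normr0_eq0 x : corner_norm x = 0 -> x = 0.
Proof. by move=> /normr0_eq0 h; apply: val_inj. Qed.

HB.instance Definition _ := Lmodule_isNormed.Build K corner
  corner_ler_normD corner_normrZ corner_normr0_eq0.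

Lemma corner_normE (x : corner) : `|x| = `|val x|.
Proof. by []. Qed.

Lemma corner_complete (F : set_system corner) :
  ProperFilter F -> cauchy F -> cvg F.
Proof.
move=> FF Fc.
have Gc : cauchy (val @ F : set_system A).
  apply: cauchy_exP => e e0; have /cauchyP/(_ e e0)[x Fx] := Fc.
  exists (val x); rewrite -ball_normE.
  by move: Fx; rewrite -ball_normE.
have /cvg_ex[/= l Fl] : cvg (val @ F : set_system A) by exact: cauchy_cvg.
have Fdist e : 0 < e -> \forall x \near F, `|l - val x| < e.
  by move=> e0; move/cvgrPdist_lt : Fl => /(_ e e0).
have lP : l \in corner_pred.
  rewrite inE; apply/negP => /negP; rewrite -subr_eq0 -normr_gt0 => d0.
  have c0 : 0 < `|p| * `|p| + 1 by rewrite ltr_wpDl// mulr_ge0.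
  have /filter_ex[x] := Fdist _ (divr_gt0 d0 c0).
  rewrite ltr_pdivlMr// => xd; suff : `|p * l * p - l| < `|p * l * p - l|.
    by rewrite ltxx.
  apply: le_lt_trans xd.
  have /eqP xE := corner_valP x.
  have -> : p * l * p - l = p * (l - val x) * p - (l - val x).
    by rewrite mulrBr mulrBl xE opprB addrA subrK.
  rewrite (le_trans (ler_normB _ _))// [leRHS]mulrDr mulr1 lerD2r.
  rewrite (le_trans (ler_normrM _ _))// mulrA [`|l - _| * _]mulrC.
  by rewrite ler_wpM2r// ler_normrM.
apply/cvg_ex; exists (Corner lP); apply/cvgrPdist_lt => e e0.
exact: Fdist.
Qed.

HB.instance Definition _ := Uniform_isComplete.Build corner corner_complete.

Lemma corner_mulP (x y : corner) : p * p = p ->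
  val x * val y \in corner_pred.
Proof.
move=> pp; case: x y => x hx [y hy] /=; apply/cornerP => //.
move: hx hy => /(cornerP _ pp)[a ->] /(cornerP _ pp)[b ->].
by exists (a * p * p * b); rewrite !mulrA.
Qed.

Lemma corner_oneP : p * p = p -> p \in corner_pred.
Proof. by move=> pp; rewrite inE !pp. Qed.

End CornerSpace.

Section CornerAlgebra.
Variables (K : numFieldType) (A : banachAlgType K) (p : A).
Hypotheses (pp : p * p = p) (p0 : p != 0).

Implicit Types x y z : corner p.

Definition corner_one : corner p := Corner (corner_oneP pp).
Definition corner_mul x y : corner p := Corner (corner_mulP x y pp).

Lemma corner_mulA : associative corner_mul.
Proof. by move=> x y z; apply: val_inj; rewrite /= mulrA. Qed.

Lemma corner_mul1r : left_id corner_one corner_mul.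
Proof.
move=> [x hx]; apply: val_inj => /=; have /eqP <- := hx.
by rewrite !mulrA pp.
Qed.

Lemma corner_mulr1 : right_id corner_one corner_mul.
Proof.
move=> [x hx]; apply: val_inj => /=; have /eqP <- := hx.
by rewrite -!mulrA pp.
Qed.

Lemma corner_mulDl : left_distributive corner_mul +%R.
Proof. by move=> x y z; apply: val_inj; rewrite /= mulrDl. Qed.

Lemma corner_mulDr : right_distributive corner_mul +%R.
Proof. by move=> x y z; apply: val_inj; rewrite /= mulrDr. Qed.

Lemma corner_scaleAl (k : K) x y :
  k *: corner_mul x y = corner_mul (k *: x) y.
Proof. by apply: val_inj; rewrite /= scalerAl. Qed.

Lemma corner_scaleAr (k : K) x y :
  k *: corner_mul x y = corner_mul x (k *: y).
Proof. by apply: val_inj; rewrite /= scalerAr. Qed.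

Lemma corner_one_neq0 : corner_one != 0.
Proof. by rewrite -val_eqE. Qed.

Lemma corner_normM x y : `|corner_mul x y| <= `|x| * `|y|.
Proof. exact: ler_normrM. Qed.

Definition corner_alg : banachAlgType K := BanachAlg
  corner_mulA corner_mul1r corner_mulr1 corner_mulDl corner_mulDr
  corner_scaleAl corner_scaleAr corner_one_neq0 corner_normM.

End CornerAlgebra.

Section Ranks.
Variables (K : numFieldType) (B : banachAlgType K).

Definition rtsr_bound (k : nat) : Prop :=
  dense [set a : 'rV[B]_k |
    exists b : 'cV[B]_k, \sum_(i < k) a 0 i * b i 0 = 1].

Definition rtsr : \bar rat :=
  match pselect (exists k, `[< (0 < k)%N /\ rtsr_bound k >]) with
  | left ex => (ex_minn ex)%:R%:E
  | right _ => +oo%E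
  end.

(** [B] need not be commutative, so [unitmx] does not apply: invertibility of a
    matrix is stated with a two-sided inverse. *)
Definition completely_finite : Prop :=
  forall (k : nat) (r : 'rV[B]_k.+1),
    (exists c : 'cV[B]_k.+1, r *m c = 1%:M) ->
    exists M N : 'M[B]_k.+1,
      [/\ M *m N = 1%:M, N *m M = 1%:M & row ord0 M = r].

End Ranks.

Definition eceil (x : \bar rat) : \bar rat :=
  er_map (fun r => (Num.ceil r)%:~R) x.

(** Indices are 1-based as in the usual notation: [pmu_P] is only meaningful on
    [1, n], and [pmu_U], [pmu_V] on [2, n]. *)
Record partial_matrix_units (K : numFieldType) (A : banachAlgType K) (n : nat) :=
  PartialMatrixUnits {
  pmu_P : nat -> A ;
  pmu_U : nat -> A ;
  pmu_V : nat -> A ;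
  pmu_size : (1 <= n)%N ;
  pmu_idem : forall i, (1 <= i <= n)%N -> pmu_P i * pmu_P i = pmu_P i ;
  pmu_orth : forall i j, (1 <= i <= n)%N -> (1 <= j <= n)%N -> i != j ->
    pmu_P i * pmu_P j = 0 ;
  pmu_sum : \sum_(1 <= i < n.+1) pmu_P i = 1 ;
  pmu_UE : forall i, (2 <= i <= n)%N -> pmu_U i = pmu_P i * pmu_U i * pmu_P 1 ;
  pmu_VE : forall i, (2 <= i <= n)%N -> pmu_V i = pmu_P 1 * pmu_V i * pmu_P i ;
  pmu_UV : forall i, (2 <= i <= n)%N -> pmu_U i * pmu_V i = pmu_P i }.

Section PartialMatrixUnits.
Variables (K : numFieldType) (A : banachAlgType K) (n : nat).
Variable M : partial_matrix_units A n.

Definition pmu_E (i : nat) : A :=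
  if i == 1%N then pmu_P M 1 else pmu_V M i * pmu_U M i.

Lemma pmu_idem1 : pmu_P M 1 * pmu_P M 1 = pmu_P M 1.
Proof. by apply: pmu_idem; rewrite (pmu_size M). Qed.

Lemma pmu_P1_neq0 : pmu_P M 1 != 0.
Proof.
apply/negP => /eqP P1; have /eqP := oner_neq0 A; apply.
rewrite -(pmu_sum M) big_nat big1// => -[//|[//|i]] /andP[_ ile].
by rewrite -(@pmu_UV _ _ _ M)// pmu_UE// P1 mulr0 mul0r.
Qed.

Definition pmu_corner : banachAlgType K := corner_alg pmu_idem1 pmu_P1_neq0.

End PartialMatrixUnits.

(* Main.v *)
(** Write [p] for [P_1], and gather the units into a row [u] and a column [v]
    with [u v = 1]. Both inequalities rest on an elimination step: let [e] be an
    idempotent matrix and [X = [Y | Z]] with [e X = X], [Z e = Z]. If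
    [[Y | Z + (1 - e)]] is a limit of right invertible matrices [X'], then
    [(1 - e) X' (1 - e)] is invertible in its corner for [X'] close enough, and a
    row operation turns [X'] into a matrix of the same shape as [X], close to
    [X], with a right inverse relative to [e].

    For the lower bound, [(d - 1) n + 1] elements of [p A p] are packed into a
    row of [d] elements of [A] (using [v], the last entry being padded by
    [1 - p]), and unpacked with [u] after the elimination.

    For the upper bound, [T] in [A^d] corresponds to the matrix over [p A p] with
    blocks [v T_l u]. In the first [d - 1] blocks only the first [m] columns are
    used, where [V_j U_j = p], so they are genuinely free. Completing a right
    invertible row to an invertible matrix and clearing below it uses up one
    column per row, so right invertible [n * ((d - 1) m + n)] matrices are dense
    as soon as right invertible rows of length [(d - 1) m + 1] are. *)
Require Import Defs.
From mathcomp Require Import all_boot all_order all_algebra archimedean.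
From mathcomp Require Import all_classical all_reals ereal topology normedtype.
From mathcomp Require Import ring.

Set Implicit Arguments.
Unset Strict Implicit.
Unset Printing Implicit Defensive.

Import Order.TTheory GRing.Theory Num.Theory.
Import numFieldNormedType.Exports.

Local Open Scope ring_scope.

(** * The entrywise l1 norm and density of right invertible rows *)

(* The sup norm of matrices is not submultiplicative, this one is. *)
Definition mxl1 (K : numFieldType) (A : banachAlgType K) m n
    (X : 'M[A]_(m, n)) : K := \sum_i \sum_j `|X i j|.

Section MatrixNorm.
Variables (K : numFieldType) (A : banachAlgType K).

Lemma mxl1_ge0 m n (X : 'M[A]_(m, n)) : 0 <= mxl1 X.
Proof. by apply: sumr_ge0 => i _; apply: sumr_ge0. Qed.

Lemma ler_mxl1D m n (X Y : 'M[A]_(m, n)) : mxl1 (X + Y) <= mxl1 X + mxl1 Y.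
Proof.
rewrite /mxl1 -big_split ler_sum// => i _.
by rewrite -big_split ler_sum// => j _; rewrite mxE ler_normD.
Qed.

Lemma mxl1N m n (X : 'M[A]_(m, n)) : mxl1 (- X) = mxl1 X.
Proof.
by apply: eq_bigr => i _; apply: eq_bigr => j _; rewrite mxE normrN.
Qed.

Lemma mxl1_dist m n (X Y : 'M[A]_(m, n)) : mxl1 (X - Y) = mxl1 (Y - X).
Proof. by rewrite -mxl1N opprB. Qed.

Lemma mxl1_0 m n : mxl1 (0 : 'M[A]_(m, n)) = 0.
Proof. by rewrite /mxl1 !big1// => i _; rewrite big1// => j _; rewrite mxE normr0. Qed.

Lemma mxl1_eq0 m n (X : 'M[A]_(m, n)) : mxl1 X = 0 -> X = 0.
Proof.
move=> /eqP; rewrite psumr_eq0 => [|i _]; last exact: sumr_ge0.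
move=> /allP X0; apply/matrixP => i j; rewrite mxE; apply/eqP.
have := X0 i; rewrite mem_index_enum => /(_ isT).
rewrite psumr_eq0// => /allP /(_ j).
by rewrite mem_index_enum normr_eq0 => /(_ isT).
Qed.

Lemma ler_mxl1M m n p (X : 'M[A]_(m, n)) (Y : 'M[A]_(n, p)) :
  mxl1 (X *m Y) <= mxl1 X * mxl1 Y.
Proof.
rewrite /mxl1 mulr_suml ler_sum// => i _.
rewrite mulr_suml; under eq_bigr do rewrite mxE.
apply: le_trans (_ : \sum_j \sum_k `|X i k| * `|Y k j| <= _).
  apply: ler_sum => j _; apply: le_trans (ler_norm_sum _ _ _) _.
  by apply: ler_sum => k _; apply: ler_normrM.
rewrite exchange_big ler_sum//= => k _; rewrite -mulr_sumr ler_wpM2l//.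
by rewrite [leRHS](bigD1 k)//= lerDl sumr_ge0// => l _; apply: sumr_ge0.
Qed.

Lemma mxl1_col_mx m1 m2 n (X : 'M[A]_(m1, n)) (Y : 'M[A]_(m2, n)) :
  mxl1 (col_mx X Y) = mxl1 X + mxl1 Y.
Proof.
rewrite /mxl1 big_split_ord; congr (_ + _).
  by apply: eq_bigr => i _; apply: eq_bigr => j _; rewrite col_mxEu.
by apply: eq_bigr => i _; apply: eq_bigr => j _; rewrite col_mxEd.
Qed.

Lemma mxl1_row_mx m n1 n2 (X : 'M[A]_(m, n1)) (Y : 'M[A]_(m, n2)) :
  mxl1 (row_mx X Y) = mxl1 X + mxl1 Y.
Proof.
rewrite /mxl1 -big_split; apply: eq_bigr => i _; rewrite big_split_ord.
by congr (_ + _); apply: eq_bigr => j _; rewrite ?row_mxEl ?row_mxEr.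
Qed.

Lemma ler_norm_mxl1 m n (X : 'M[A]_(m, n)) i j : `|X i j| <= mxl1 X.
Proof.
rewrite /mxl1 (bigD1 i)//= (bigD1 j)//= -addrA lerDl addr_ge0//.
  exact: sumr_ge0.
by apply: sumr_ge0 => k _; apply: sumr_ge0.
Qed.

Lemma mxl1_le_const m n (X : 'M[A]_(m, n)) c :
  (forall i j, `|X i j| <= c) -> mxl1 X <= c *+ (m * n).
Proof.
move=> Xc; apply: le_trans (_ : \sum_(i < m) \sum_(j < n) c <= _).
  by apply: ler_sum => i _; apply: ler_sum.
by rewrite !sumr_const !card_ord -mulrnA mulnC.
Qed.

(** On rows of fixed length the sup and l1 norms are equivalent, so density can be tested with the
    submultiplicative norm. *)
Lemma rtsr_boundP k : rtsr_bound A k <->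
  forall (a : 'rV[A]_k) (e : K), 0 < e ->
    exists a' : 'rV[A]_k, mxl1 (a' - a) <= e /\ exists b : 'cV[A]_k, a' *m b = 1%:M.
Proof.
have invE (a : 'rV[A]_k) (b : 'cV[A]_k) :
    \sum_(i < k) a 0 i * b i 0 = 1 <-> a *m b = 1%:M.
  split=> [ab|/matrixP/(_ 0 0)]; last by rewrite !mxE.
  by apply/matrixP => i j; rewrite !ord1 !mxE ab.
split=> [dA a e e0|dA O [a Oa] Oop].
(* Dividing by [k.+1] rather than [k] also covers the empty row. *)
- have k0 : 0 < k.+1%:R :> K by rewrite ltr0n.
  have [|a' [a'a [b /invE ab]]] := dA _ _ (open_interior (ball a (e / k.+1%:R))).
    exists a; apply: nbhsx_ballx; exact: divr_gt0.
  exists a'; split; last by exists b.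
  have {}a'a := interior_subset a'a.
  apply: le_trans (mxl1_le_const (c := e / k.+1%:R) _) _.
    move=> i j; apply: ltW; rewrite !mxE distrC.
    by have := a'a.2 i j; rewrite -ball_normE.
  rewrite mul1n -[leLHS]mulr_natr -mulrA; apply: ler_piMr; first exact: ltW.
  by rewrite mulrC ler_pdivrMr// mul1r ler_nat.
- have /nbhs_ballP[e /= e0 eO] : nbhs a O by apply: open_nbhs_nbhs.
  have [|a' [a'a [b ab]]] := dA a (e / 2); first by rewrite divr_gt0.
  exists a'; split; last by exists b; apply/invE.
  apply: eO; split=> // i j; rewrite -ball_normE /=.
  have := ler_norm_mxl1 (a' - a) i j; rewrite !mxE distrC => h.
  by apply: le_lt_trans h _; apply: le_lt_trans a'a _; rewrite ltr_pdivrMr// ltr_pMr// ltr1n.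
Qed.

End MatrixNorm.

(** * Inverses of matrices close to the identity *)

Section Neumann.
Variables (K : archiNumFieldType) (A : banachAlgType K).

Lemma exists_lt_expr2 (c : K) : 0 <= c -> exists k, c < 2 ^+ k.
Proof.
move=> c0; exists (Num.bound c); apply: lt_le_trans (archi_boundP c0) _.
by rewrite -natrX ler_nat ltnW// ltn_expl.
Qed.

Lemma ge0_ler_expr2_eq0 (x D : K) : 0 <= x -> 0 <= D ->
  (forall k, x <= D / 2 ^+ k) -> x = 0.
Proof.
move=> x0 D0 xD; apply/eqP; apply: contraT => xn0.
have {}x0 : 0 < x by rewrite lt_def xn0.
have [k Dk] := exists_lt_expr2 (divr_ge0 D0 (ltW x0)).
have := xD k; rewrite ler_pdivlMr ?exprn_gt0// => /le_lt_trans.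
by move: Dk; rewrite ltr_pdivrMr// mulrC => Dk /(_ _ Dk); rewrite ltxx.
Qed.

(** The increments telescope against a geometric series with tails [2 * c / 2 ^+ k]. The factor 4
    pays for comparing [l] with a late term of the sequence instead of passing to the limit in an
    inequality. *)
Lemma geometric_cvg (u : nat -> A) (c : K) : 0 < c ->
  (forall k, `|u k.+1 - u k| <= c / 2 ^+ k) ->
  exists l, forall k, `|l - u k| <= 4 * c / 2 ^+ k.
Proof.
move=> c0 uc.
have udist k p : `|u (k + p)%N - u k| <= 2 * c / 2 ^+ k - 2 * c / 2 ^+ (k + p).
  elim: p => [|p IH]; first by rewrite addn0 !subrr normr0.
  have -> : u (k + p.+1)%N - u k =
    (u (k + p).+1 - u (k + p)%N) + (u (k + p)%N - u k).
    by rewrite addnS addrA subrK.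
  apply: le_trans (ler_normD _ _) _; apply: le_trans (lerD (uc _) IH) _.
  rewrite addnS [2 ^+ (k + p).+1]exprS le_eqVlt; apply/orP; left; apply/eqP.
  by field; rewrite !expf_neq0 // pnatr_eq0.
have pos k : 0 < 2 * c / 2 ^+ k.
  by rewrite divr_gt0 ?exprn_gt0 // mulr_gt0.
have {}udist k p : `|u (k + p)%N - u k| <= 2 * c / 2 ^+ k.
  apply: le_trans (udist _ _) _; rewrite gerBl; exact: ltW.
have : cvg (u @ \oo)%classic.
  apply: cauchy_cvg; apply: cauchy_exP => e e0.
  have [k ck] := exists_lt_expr2 (divr_ge0 (ltW (mulr_gt0 (ltr0n _ 2) c0)) (ltW e0)).
  exists (u k); exists k => // p /= kp; rewrite -ball_normE /= distrC -(subnKC kp).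
  apply: le_lt_trans (udist _ _) _.
  by rewrite ltr_pdivrMr ?exprn_gt0 // [ltRHS]mulrC -ltr_pdivrMr.
move=> /cvg_ex[/= l ul]; exists l => k.
move/cvgrPdist_lt : ul => /(_ _ (pos k))[p _ lp].
have -> : l - u k = (l - u (k + p)%N) + (u (k + p)%N - u k) by rewrite addrA subrK.
apply: le_trans (ler_normD _ _) _.
apply: le_trans (lerD (ltW (lp _ (leq_addl _ _))) (udist _ _)) _.
by rewrite le_eqVlt; apply/orP; left; apply/eqP; ring.
Qed.

(** The bound [G] is uniform in [w], so elimination can fix its tolerance before the perturbed
    matrix is known. The limit is taken entry by entry, by completeness of [A]. *)
Lemma neumann_mx n : exists2 G : K, 0 <= G &
  forall w : 'M[A]_n, mxl1 (w - 1%:M) <= 2^-1 ->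
    exists2 g : 'M[A]_n, mxl1 g <= G & g *m w = 1%:M.
Proof.
(* [c] dominates the norm of the identity, which need not be 1, and is itself at least 1. *)
set c := mxl1 (1%:M : 'M[A]_n) + 1.
have c0 : 0 < c by rewrite ltr_wpDl// mxl1_ge0.
set D := (4 * c) *+ (n * n).
have D0 : 0 <= D by rewrite mulrn_wge0// mulr_ge0// ltW.
exists (c + D) => [|w w1]; first by rewrite addr_ge0// ltW.
set x := 1%:M - w.
have x1 : mxl1 x <= 2^-1 by rewrite mxl1_dist.
(* Partial sums of the Neumann series [\sum_k x ^+ k]. *)
pose u k : 'M[A]_n := iter k (fun g => 1%:M + g *m x) 1%:M.
have uS k : u k.+1 = 1%:M + u k *m x by [].
have uc k : mxl1 (u k.+1 - u k) <= c / 2 ^+ k.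
  elim: k => [|k IH].
    rewrite uS addrC addKr mul1mx expr0 divr1 (le_trans x1)//.
    rewrite (@le_trans _ _ 1)// ?lerDr ?mxl1_ge0//.
    by rewrite invf_le1// ler1n.
  rewrite uS [u k.+1 in X in _ - X]uS opprD addrACA subrr add0r -mulmxBl.
  apply: le_trans (ler_mxl1M _ _) _.
  apply: le_trans (ler_pM (mxl1_ge0 _) (mxl1_ge0 _) IH x1) _.
  by rewrite exprSr invfM mulrA.
have ent i j : exists l, forall k, `|l - u k i j| <= 4 * c / 2 ^+ k.
  apply: geometric_cvg => // k; apply: le_trans (uc k).
  by have := ler_norm_mxl1 (u k.+1 - u k) i j; rewrite !mxE.
pose g : 'M[A]_n := \matrix_(i, j) sval (cid (ent i j)).
have gu k : mxl1 (g - u k) <= D / 2 ^+ k.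
  rewrite /D mulrnAl; apply: mxl1_le_const => i j; rewrite !mxE.
  by case: cid => l /= /(_ k).
exists g.
  have -> : g = (g - u 0%N) + 1%:M by rewrite subrK.
  apply: le_trans (ler_mxl1D _ _) _; rewrite addrC lerD// ?lerDl//.
  by apply: le_trans (gu _) _; rewrite expr0 divr1.
(* The recursion for [u] makes its limit a fixed point; with [x = 1%:M - w] this reads
   [g *m w = 1%:M]. *)
have gE : g - (1%:M + g *m x) = 0.
  apply: mxl1_eq0; apply: (@ge0_ler_expr2_eq0 _ (D + D)).
  - exact: mxl1_ge0.
  - exact: addr_ge0.
  move=> k.
  have -> : g - (1%:M + g *m x) = (g - u k.+1) + (u k - g) *m x.
    by rewrite uS mulmxBl !opprD !addrA; congr (_ + _); rewrite subrK.
  apply: le_trans (ler_mxl1D _ _) _; rewrite mulrDl lerD//.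
    apply: le_trans (gu _) _; rewrite ler_wpM2l// lef_pV2 ?posrE ?exprn_gt0//.
    by rewrite ler_eXn2l// ltr1n.
  apply: le_trans (ler_mxl1M _ _) _.
  rewrite -[leRHS]mulr1.
  apply: ler_pM; rewrite ?mxl1_ge0//; first by rewrite mxl1_dist gu.
  by apply: le_trans x1 _; rewrite invf_le1// ler1n.
move/subr0_eq : gE; rewrite /x mulmxBr mulmx1 => gE.
by apply: (addIr (g - g *m w)); rewrite -gE addrC subrK.
Qed.

End Neumann.

(** * Elimination, and right invertible matrices over completely finite algebras *)

Ltac nonneg :=
  do ?[apply: addr_ge0 | apply: mulr_ge0 | apply: mxl1_ge0] => //;
  rewrite ?invr_ge0; try exact: ltW.

Section Elimination.
Variables (K : archiNumFieldType) (A : banachAlgType K).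

(* [1%:M - e] plays the role of the unit of the complementary corner: a matrix
   over the corner of [e] is padded by it before being perturbed. *)
Lemma approx_corner_right_invertible r N (e : 'M[A]_r)
    (Y : 'M[A]_(r, N)) (Z : 'M[A]_r) :
  e *m e = e -> e *m Y = Y -> e *m Z = Z -> Z *m e = Z ->
  (forall eps : K, 0 < eps ->
    exists (Y' : 'M[A]_(r, N)) (Z' : 'M[A]_r)
           (C1 : 'M[A]_(N, r)) (C2 : 'M[A]_r),
      [/\ mxl1 (Y' - Y) <= eps, mxl1 (Z' - (Z + (1%:M - e))) <= eps
        & Y' *m C1 + Z' *m C2 = 1%:M]) ->
  forall eps : K, 0 < eps ->
    exists (Y' : 'M[A]_(r, N)) (Z' : 'M[A]_r)
           (C1 : 'M[A]_(N, r)) (C2 : 'M[A]_r),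
      [/\ mxl1 (Y' - Y) <= eps, mxl1 (Z' - Z) <= eps,
          e *m Y' = Y', e *m Z' = Z' /\ Z' *m e = Z'
        & Y' *m C1 + Z' *m C2 = e].
Proof.
move=> ee eY eZ Ze approx eps eps0.
move qE : (1%:M - e) approx => q approx.
have eq0 : e *m q = 0 by rewrite -qE mulmxBr mulmx1 ee subrr.
have qe0 : q *m e = 0 by rewrite -qE mulmxBl mul1mx ee subrr.
have Zq : Z *m q = 0 by rewrite -qE mulmxBr mulmx1 Ze subrr.
have qq : q *m q = q by rewrite -{1}qE mulmxBl mul1mx eq0 subr0.
have [G G0 inv] := neumann_mx A r.
set ne := mxl1 e; set nq := mxl1 q.
have ne0 : 0 <= ne by apply: mxl1_ge0.
have nq0 : 0 <= nq by apply: mxl1_ge0.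
(* [nX] bounds [Y'] and [Z'], which stay within 1 of [Y] and [Z + q]; [d * D] bounds the error after
   the row operation. *)
set nX := mxl1 Y + mxl1 Z + nq + 1.
have nX0 : 0 <= nX by rewrite /nX; nonneg.
set D := ne + (ne * nq) * (G * (nq * nX)).
have D0 : 0 <= D by rewrite /D; nonneg.
(* One [d] meets three demands: [d <= 1], [d * D <= eps], and [w] below within 1/2 of the
   identity. *)
set d := (1 + D / eps + 2 * (nq * nq))^-1.
have dden : 0 < 1 + D / eps + 2 * (nq * nq).
  by rewrite -addrA ltr_pwDl//; nonneg.
have d0 : 0 < d by rewrite invr_gt0.
have d1 : d <= 1.
  by rewrite invf_le1// -addrA lerDl; nonneg.
have dD : d * D <= eps.
  rewrite mulrC ler_pdivrMr// -ler_pdivrMl// mulrC.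
  by rewrite [X in _ <= X + _]addrC -addrA lerDl addr_ge0// !mulr_ge0.
have dq : d * (nq * nq) <= 2^-1.
  rewrite mulrC ler_pdivrMr// mulrDr mulrA mulVf ?pnatr_eq0// mul1r.
  by rewrite lerDr; nonneg.
have [Y' [Z' [C1 [C2 [Y'Y Z'Z YZ1]]]]] := approx d d0.
(* Since [q *m (Z + q) *m q = q], this is close to [q + e = 1%:M]. *)
set w := q *m Z' *m q + e.
have w1 : mxl1 (w - 1%:M) <= 2^-1.
  have -> : w - 1%:M = q *m (Z' - (Z + q)) *m q.
    rewrite mulmxBr mulmxBl mulmxDr mulmxDl -[q *m Z *m q]mulmxA Zq mulmx0.
    by rewrite add0r !qq /w -addrA; congr (_ + _); rewrite -qE opprB.
  apply: le_trans (ler_mxl1M _ _) _.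
  apply: le_trans (ler_wpM2r nq0 (ler_mxl1M _ _)) _.
  rewrite -/nq mulrC mulrA mulrC; apply: le_trans (ler_wpM2r _ Z'Z) _ => //.
  exact: mulr_ge0.
have [g gG gw] := inv _ w1.
have we : w *m e = e by rewrite mulmxDl -mulmxA qe0 mulmx0 add0r ee.
have ge : g *m e = e by rewrite -{1}we mulmxA gw mul1mx.
have gqZq : g *m (q *m Z' *m q) = q.
  by rewrite -[q *m Z' *m q](addrK e) -/w mulmxBr gw ge.
(* Multiplying by [e - s] on the left clears [Z' *m q]. As [s *m e = 0], it fixes [e], so a right
   inverse relative to [e] survives. *)
have [s sE] : exists s, s = e *m Z' *m q *m (g *m q) by eexists.
have es : e *m s = s by rewrite sE !mulmxA ee.
pose T N (X : 'M[A]_(r, N)) := e *m X - s *m X.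
have eT M (X : 'M[A]_(r, M)) : e *m T M X = T M X.
  by rewrite /T mulmxBr !mulmxA ee es.
have Tdist M (X X0 : 'M[A]_(r, M)) : mxl1 X <= nX ->
    mxl1 (e *m X - X0) <= d * ne -> mxl1 (T M X - X0) <= eps.
  move=> XnX XX0; apply: le_trans dD.
  rewrite /T addrAC; apply: le_trans (ler_mxl1D _ _) _.
  rewrite mxl1N /D mulrDr lerD//.
  (* This factor makes [s] of order [d]: [e *m (Z + q) *m q = 0]. *)
  have eZq : mxl1 (e *m Z' *m q) <= d * (ne * nq).
    have -> : e *m Z' *m q = e *m (Z' - (Z + q)) *m q.
      by rewrite mulmxBr mulmxDr eZ eq0 addr0 mulmxBl Zq subr0.
    apply: le_trans (ler_mxl1M _ _) _.
    apply: le_trans (ler_wpM2r nq0 (ler_mxl1M _ _)) _.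
    rewrite mulrA ler_wpM2r// mulrC ler_wpM2r//.
  apply: le_trans (ler_mxl1M _ _) _; rewrite sE.
  apply: le_trans (ler_wpM2r (mxl1_ge0 _) (ler_mxl1M _ _)) _.
  rewrite -[leLHS]mulrA [leRHS]mulrA; apply: ler_pM => //; nonneg.
  rewrite [leRHS]mulrA; apply: ler_pM => //; nonneg.
  apply: le_trans (ler_mxl1M _ _) _.
  apply: ler_pM; nonneg.
have sZq : s *m Z' *m q = e *m Z' *m q.
  transitivity (e *m Z' *m q *m (g *m (q *m Z' *m q))); first by rewrite sE !mulmxA.
  by rewrite gqZq -mulmxA qq.
have TE M (X : 'M[A]_(r, M)) : T M X = (e - s) *m X by rewrite mulmxBl.
exists (T N Y'), (T r Z'), (C1 *m e), (C2 *m e); split.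
- apply: Tdist.
    rewrite -[Y'](subrK Y); apply: le_trans (ler_mxl1D _ _) _.
    apply: le_trans (lerD (le_trans Y'Y d1) (lexx _)) _.
    by rewrite /nX [leRHS]addrC lerD2l -addrA lerDl; nonneg.
  rewrite -[X in _ - X]eY -mulmxBr mulrC.
  by apply: le_trans (ler_mxl1M _ _) _; rewrite ler_wpM2l.
- apply: Tdist.
    rewrite -[Z'](subrK (Z + q)); apply: le_trans (ler_mxl1D _ _) _.
    apply: le_trans (lerD (le_trans Z'Z d1) (ler_mxl1D _ _)) _.
    by rewrite /nX [leRHS]addrC lerD2l -addrA lerDr; nonneg.
  have -> : e *m Z' - Z = e *m (Z' - (Z + q)).
    by rewrite mulmxBr mulmxDr eq0 addr0 eZ.
  by apply: le_trans (ler_mxl1M _ _) _; rewrite mulrC ler_wpM2r.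
- exact: eT.
- split; first exact: eT.
  suff Tq : T r Z' *m q = 0.
    by apply/esym/subr0_eq; rewrite -[X in X - _]mulmx1 -mulmxBr qE.
  by rewrite /T mulmxBl sZq subrr.
- rewrite !TE -!mulmxA -mulmxDr [Y' *m _]mulmxA [Z' *m _]mulmxA -mulmxDl YZ1.
  by rewrite mul1mx mulmxBl ee sE -!mulmxA qe0 !mulmx0 subr0.
Qed.

End Elimination.

Section CompletelyFinite.
Variables (K : archiNumFieldType) (A : banachAlgType K).

Lemma rtsr_bound_leq k l : (k <= l)%N -> rtsr_bound A k -> rtsr_bound A l.
Proof.
move=> kl /rtsr_boundP dk; apply/rtsr_boundP; rewrite -(subnKC kl).
move=> a e e0; have [a' [a'a [b ab]]] := dk (lsubmx a) e e0.
exists (row_mx a' (rsubmx a)); split.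
  rewrite -{2}(hsubmxK a) opp_row_mx add_row_mx mxl1_row_mx subrr mxl1_0.
  by rewrite addr0.
by exists (col_mx b 0); rewrite mul_row_col mulmx0 addr0.
Qed.

(** Induction on the rows. After a perturbation the first row is that of an invertible [W], and
    multiplying by its inverse gives the block form [[1, 0; c, D]]. Only [D] remains to be
    perturbed; it has one row and one column less, so [N + r <= M] persists. *)
Lemma completely_finite_right_invertible_dense r M N :
  completely_finite A -> rtsr_bound A N.+1 -> (N + r <= M)%N ->
  forall (X : 'M[A]_(r, M)) (e : K), 0 < e ->
    exists X' : 'M[A]_(r, M), mxl1 (X' - X) <= e /\
      exists C : 'M[A]_(M, r), X' *m C = 1%:M.
Proof.
move=> cf dN; elim: r M => [|r IH] [|M] NM X e e0.
- exists X; split; first by rewrite subrr mxl1_0 ltW.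
  by exists 0; apply/matrixP => -[].
- exists X; split; first by rewrite subrr mxl1_0 ltW.
  by exists 0; apply/matrixP => -[].
- by rewrite addnS in NM.
have {}NM : (N + r <= M)%N by rewrite addnS in NM.
have /rtsr_boundP dM : rtsr_bound A M.+1.
  by apply: rtsr_bound_leq dN; rewrite ltnS (leq_trans (leq_addr r N)).
pose x : 'rV[A]_M.+1 := usubmx (X : 'M_(1 + r, M.+1)).
pose X2 : 'M[A]_(r, M.+1) := dsubmx (X : 'M_(1 + r, M.+1)).
have [x' [x'x /cf[W [W' [WW' W'W Wx]]]]] := dM x _ (divr_gt0 e0 (ltr0n _ 2)).
pose c : 'M[A]_(r, 1) := lsubmx (X2 *m W' : 'M_(r, 1 + M)).
pose D : 'M[A]_(r, M) := rsubmx (X2 *m W' : 'M_(r, 1 + M)).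
have cD : row_mx c D *m W = X2 by rewrite hsubmxK -mulmxA W'W mulmx1.
(* Multiplying back by [W] must cost at most [e / 2]. *)
set d := e / 2 / (mxl1 W + 1).
have W1 : 0 < mxl1 W + 1 by rewrite ltr_wpDl// mxl1_ge0.
have [D' [D'D [F DF]]] := IH M NM D d (divr_gt0 (divr_gt0 e0 (ltr0n _ 2)) W1).
have x'E : x' = row_mx 1%:M 0 *m (W : 'M_(1 + M, M.+1)).
  rewrite -Wx rowE; congr (_ *m _); apply/matrixP => i j.
  rewrite !mxE; case: split_ordP => k ->; rewrite !mxE !ord1 ?eqxx /=.
    by [].
  by [].
exists (col_mx x' (row_mx c D' *m (W : 'M_(1 + M, M.+1)))); split.
  have -> : col_mx x' (row_mx c D' *m W) - X =
      col_mx (x' - x) (row_mx c D' *m W - X2).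
    by rewrite -add_col_mx -opp_col_mx vsubmxK.
  have -> : mxl1 (col_mx (x' - x) (row_mx c D' *m W - X2)) =
      mxl1 (x' - x) + mxl1 (row_mx c D' *m W - X2) by exact: mxl1_col_mx.
  rewrite [leRHS]splitr lerD// -cD -mulmxBl opp_row_mx add_row_mx.
  rewrite subrr; apply: le_trans (ler_mxl1M _ _) _.
  rewrite mxl1_row_mx mxl1_0 add0r.
  apply: le_trans (ler_wpM2r (mxl1_ge0 _) D'D) _.
  rewrite -mulrA ler_piMr ?divr_ge0 ?(ltW e0)// mulrC ler_pdivrMr// mul1r.
  by rewrite lerDl.
(* The second factor is a right inverse of [[1, 0; c, D']], as [D' *m F = 1%:M]. *)
exists ((W' : 'M_(M.+1, 1 + M)) *m block_mx 1%:M 0 (- (F *m c)) F).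
rewrite x'E -mul_col_mx mulmxA -[_ *m W *m W']mulmxA WW' mulmx1.
transitivity (block_mx 1%:M 0 c D' *m block_mx 1%:M 0 (- (F *m c)) F); first by [].
rewrite mulmx_block !mulmx0 !mul0mx !mul1mx !addr0 mulmxN.
by rewrite mulmxA DF mul1mx mulmx1 subrr add0r -scalar_mx_block.
Qed.

End CompletelyFinite.

(** * Matrices over a corner *)

(* [U] and [V] are block diagonal with [d] copies of [u] and of [v]. *)
Lemma ampliation (R : nzRingType) n (u : 'rV[R]_n) (v : 'cV[R]_n) d :
  exists (U : 'M[R]_(d, d * n)) (V : 'M[R]_(d * n, d)),
    [/\ forall x, u *m x%:M = u -> U *m x%:M = U,
        forall x, x%:M *m v = v -> x%:M *m V = V,
        forall x, u *m v = x%:M -> U *m V = x%:M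
      & forall x, v *m u = x%:M -> V *m U = x%:M].
Proof.
elim: d => [|d [U [V [Ux xV UV VU]]]].
  by exists 0, 0; split=> x _; rewrite ?flatmx0 // thinmx0.
exists (block_mx u 0 0 U : 'M_(1 + d, n + d * n)).
exists (block_mx v 0 0 V : 'M_(n + d * n, 1 + d)).
split=> x hx.
- suff: block_mx u 0 0 U *m x%:M = block_mx u 0 0 U by [].
  by rewrite scalar_mx_block mulmx_block !mulmx0 !mul0mx !addr0 !add0r hx Ux.
- suff: x%:M *m block_mx v 0 0 V = block_mx v 0 0 V by [].
  by rewrite scalar_mx_block mulmx_block !mulmx0 !mul0mx !addr0 !add0r hx xV.
- suff: block_mx u 0 0 U *m block_mx v 0 0 V = x%:M by [].
  by rewrite mulmx_block !mulmx0 !mul0mx !addr0 !add0r hx (UV _ hx) -scalar_mx_block.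
- suff: block_mx v 0 0 V *m block_mx u 0 0 U = x%:M by [].
  by rewrite mulmx_block !mulmx0 !mul0mx !addr0 !add0r hx (VU _ hx) -scalar_mx_block.
Qed.

Section CornerMatrices.
Variables (K : archiNumFieldType) (A : banachAlgType K) (p : A).
Hypotheses (pp : p * p = p) (p0 : p != 0).

Let B := corner_alg pp p0.

(** Over [A], corner matrices can be multiplied by [u] and [v], but the corner identity becomes
    [p%:M]. *)
Definition corner_mx m n (X : 'M[B]_(m, n)) : 'M[A]_(m, n) :=
  \matrix_(i, j) corner_val (X i j : corner p).

Lemma corner_mx_inj m n : injective (@corner_mx m n).
Proof.
by move=> X Y /matrixP XY; apply/matrixP => i j; apply: val_inj; have := XY i j; rewrite !mxE.
Qed.

Lemma corner_mxD m n (X Y : 'M[B]_(m, n)) :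
  corner_mx (X + Y) = corner_mx X + corner_mx Y.
Proof. by apply/matrixP => i j; rewrite !mxE. Qed.

Lemma corner_mxB m n (X Y : 'M[B]_(m, n)) :
  corner_mx (X - Y) = corner_mx X - corner_mx Y.
Proof. by apply/matrixP => i j; rewrite !mxE. Qed.

Lemma corner_mxM m n k (X : 'M[B]_(m, n)) (Y : 'M[B]_(n, k)) :
  corner_mx (X *m Y) = corner_mx X *m corner_mx Y.
Proof.
apply/matrixP => i j; rewrite !mxE.
rewrite (@big_morph _ _ (@corner_val K A p : B -> A) 0 +%R 0 +%R)//.
by apply: eq_bigr => l _; rewrite !mxE.
Qed.

Lemma corner_mx1 n : corner_mx (1%:M : 'M_n) = p%:M.
Proof. by apply/matrixP => i j; rewrite !mxE; case: (i == j). Qed.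

Lemma corner_mx_row m n1 n2 (X : 'M[B]_(m, n1)) (Y : 'M[B]_(m, n2)) :
  corner_mx (row_mx X Y) = row_mx (corner_mx X) (corner_mx Y).
Proof.
by apply/matrixP => i j; rewrite !mxE; case: splitP => k _; rewrite mxE.
Qed.

Lemma mxl1_corner_mx m n (X : 'M[B]_(m, n)) : mxl1 (corner_mx X) = mxl1 X.
Proof. by apply: eq_bigr => i _; apply: eq_bigr => j _; rewrite mxE. Qed.

Lemma mul_scalar_corner_mx m n (X : 'M[B]_(m, n)) :
  p%:M *m corner_mx X = corner_mx X.
Proof. by rewrite -corner_mx1 -corner_mxM mul1mx. Qed.

Lemma mul_corner_mx_scalar m n (X : 'M[B]_(m, n)) :
  corner_mx X *m p%:M = corner_mx X.
Proof. by rewrite -corner_mx1 -corner_mxM mulmx1. Qed.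

Lemma corner_mx_lift m n (X : 'M[A]_(m, n)) :
  p%:M *m X = X -> X *m p%:M = X -> exists Y : 'M[B]_(m, n), corner_mx Y = X.
Proof.
move=> pX Xp.
have XP i j : X i j \in corner_pred p.
  rewrite inE -{2}Xp -{2}pX; apply/eqP.
  have pXE k l : (p%:M *m X) k l = p * X k l.
    rewrite mxE (bigD1 k)//= big1 => [|q qk]; first by rewrite mxE eqxx addr0.
    by rewrite mxE eq_sym (negPf qk) mul0r.
  rewrite mxE (bigD1 j)//= big1 => [|q qj]; first by rewrite pXE mxE eqxx addr0.
  by rewrite [p%:M _ _]mxE (negPf qj) mulr0.
exists (\matrix_(i, j) (Corner (XP i j) : B)).
by apply/matrixP => i j; rewrite !mxE.
Qed.

(** * Transfer of density between the algebra and its corner *)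

Variables (n : nat) (u : 'rV[A]_n) (v : 'cV[A]_n).
Hypotheses (uv : u *m v = 1%:M) (up : u *m p%:M = u) (pv : p%:M *m v = v).

Lemma rtsr_bound_corner d : rtsr_bound A d.+1 -> rtsr_bound B (d * n).+1.
Proof.
move=> /rtsr_boundP dA; apply/rtsr_boundP => a e e0.
have [U [V [Up pV UV _]]] := ampliation u v d.
move: (Up _ up) (pV _ pv) (UV _ uv) => {}Up {}pV {}UV.
set z := corner_mx (lsubmx (a : 'M_(1, 1 + d * n))).
set y := corner_mx (rsubmx (a : 'M_(1, 1 + d * n))).
have aE : corner_mx a = row_mx z y :> 'M_(1, 1 + d * n).
  by rewrite -corner_mx_row hsubmxK.
have c0 : 0 < 1 + mxl1 U by rewrite ltr_pwDl// mxl1_ge0.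
have [|||||t1 [t2 [C1 [C2 [t1y t2z pt1 [pt2 t2p] tC]]]]] :=
  @approx_corner_right_invertible _ A 1 d p%:M (y *m V) z _ _ _ _ _ _
    (divr_gt0 e0 c0).
- by rewrite -scalar_mxM pp.
- by rewrite mulmxA mul_scalar_corner_mx.
- exact: mul_scalar_corner_mx.
- exact: mul_corner_mx_scalar.
- move=> eps eps0.
  have [x [xX [c xc]]] :=
    dA (row_mx (z + (1%:M - p%:M)) (y *m V) : 'M_(1, 1 + d)) eps eps0.
  pose x1 := lsubmx (x : 'M_(1, 1 + d)); pose x2 := rsubmx (x : 'M_(1, 1 + d)).
  have {}xX : mxl1 (x1 - (z + (1%:M - p%:M))) + mxl1 (x2 - y *m V) <= eps.
    by rewrite -mxl1_row_mx -add_row_mx -opp_row_mx hsubmxK.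
  exists x2, x1, (dsubmx (c : 'M_(1 + d, 1))), (usubmx (c : 'M_(1 + d, 1))); split.
  + by apply: le_trans xX; rewrite lerDr mxl1_ge0.
  + by apply: le_trans xX; rewrite lerDl mxl1_ge0.
  + by rewrite addrC -mul_row_col hsubmxK vsubmxK.
have yp : y *m p%:M = y by apply: mul_corner_mx_scalar.
have py : p%:M *m y = y by apply: mul_scalar_corner_mx.
(* [V *m U] may differ from [p%:M], so [t1 *m U] loses part of [y]. The term [y *m (p%:M - V *m U)]
   restores it and vanishes after multiplication by [V]. *)
have [||a' a'E] := @corner_mx_lift 1 (1 + d * n)
  (row_mx t2 (t1 *m U + y *m (p%:M - V *m U))).
- by rewrite mul_mx_row mulmxDr !mulmxA pt1 pt2 py.
- rewrite [X in _ *m X]scalar_mx_block mul_row_block !mulmx0 addr0 add0r.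
  by rewrite mulmxDl -!mulmxA mulmxBl -scalar_mxM pp -mulmxA Up t2p.
have [||b bE] := @corner_mx_lift (1 + d * n) 1
  (col_mx (p%:M *m C2 *m p%:M) (V *m C1 *m p%:M)).
- rewrite [X in X *m _]scalar_mx_block mul_block_col !mul0mx addr0 add0r.
  by rewrite !mulmxA -scalar_mxM pp pV.
- by rewrite mul_col_mx -!mulmxA -scalar_mxM pp.
exists a'; split.
  have -> : mxl1 (a' - a) =
      mxl1 (t2 - z) + mxl1 (t1 *m U + y *m (p%:M - V *m U) - y).
    by rewrite -mxl1_corner_mx corner_mxB a'E aE -mxl1_row_mx -add_row_mx -opp_row_mx.
  have -> : t1 *m U + y *m (p%:M - V *m U) - y = (t1 - y *m V) *m U.
    by rewrite mulmxBr yp mulmxBl mulmxA -addrA [y - _ - y]addrAC subrr add0r.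
  apply: le_trans (lerD t2z (ler_mxl1M _ _)) _.
  apply: le_trans (lerD (lexx _) (ler_wpM2r (mxl1_ge0 _) t1y)) _.
  by rewrite -{1}[e / _]mulr1 -mulrDr divfK ?gt_eqF.
exists b; apply: corner_mx_inj; rewrite corner_mxM corner_mx1.
have -> : corner_mx a' *m corner_mx b = t2 *m (p%:M *m C2 *m p%:M)
    + (t1 *m U + y *m (p%:M - V *m U)) *m (V *m C1 *m p%:M).
  by rewrite a'E bE; apply: mul_row_col.
rewrite !mulmxA t2p mulmxDl -[t1 *m U *m V]mulmxA UV mulmx1.
rewrite mulmxBr yp mulmxBl mulmxA -[_ *m U *m V]mulmxA UV mulmx1 subrr addr0.
by rewrite -mulmxDl addrC tC -scalar_mxM pp.
Qed.

(** The elimination takes place over the corner, with idempotent [v *m u]. The last block uses all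
    [n] units, so that [u *m v = 1%:M] recovers its entry of [T]; the others use [um], [vm], for
    which [vm *m um = p%:M]. *)
Lemma rtsr_bound_of_corner m (um : 'rV[A]_m) (vm : 'cV[A]_m) d :
  um *m p%:M = um -> p%:M *m vm = vm -> vm *m um = p%:M ->
  completely_finite B -> rtsr_bound B (d * m).+1 -> rtsr_bound A d.+1.
Proof.
move=> ump pvm vum cf dB; apply/rtsr_boundP => T e e0.
have [U [V [Up pV _ VU]]] := ampliation um vm d.
move: (Up _ ump) (pV _ pvm) (VU _ vum) => {}Up {}pV {}VU.
pose T2 := lsubmx (T : 'M_(1, 1 + d)); pose T1 := rsubmx (T : 'M_(1, 1 + d)).
have TE : T = row_mx T2 T1 :> 'M_(1, 1 + d) by rewrite hsubmxK.
have [||Y YE] := @corner_mx_lift _ _ (v *m T1 *m U).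
- by rewrite !mulmxA pv.
- by rewrite -mulmxA Up.
have [||Z ZE] := @corner_mx_lift _ _ (v *m T2 *m u).
- by rewrite !mulmxA pv.
- by rewrite -mulmxA up.
have [||E EE] := @corner_mx_lift _ _ (v *m u).
- by rewrite !mulmxA pv.
- by rewrite -mulmxA up.
set c := mxl1 u * mxl1 v + mxl1 u * mxl1 V + 1.
have c0 : 0 < c.
  by rewrite ltr_wpDl// addr_ge0// mulr_ge0// mxl1_ge0.
have [|||||t1 [t2 [C1 [C2 [t1Y t2Z Et1 [Et2 t2E] tC]]]]] :=
  @approx_corner_right_invertible _ B n (d * m) E Y Z _ _ _ _ _ _
    (divr_gt0 e0 c0).
- by apply: corner_mx_inj; rewrite corner_mxM EE mulmxA -[v *m u *m v]mulmxA uv mulmx1.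
- by apply: corner_mx_inj; rewrite corner_mxM EE YE !mulmxA -[v *m u *m v]mulmxA uv mulmx1.
- by apply: corner_mx_inj; rewrite corner_mxM EE ZE !mulmxA -[v *m u *m v]mulmxA uv mulmx1.
- by apply: corner_mx_inj; rewrite corner_mxM EE ZE !mulmxA -[_ *m u *m v]mulmxA uv mulmx1.
- move=> eps eps0.
  have [x [xX [C xC]]] := completely_finite_right_invertible_dense cf dB
    (leqnn (d * m + n)) (row_mx Y (Z + (1%:M - E))) eps0.
  rewrite -[x]hsubmxK -[C]vsubmxK in xX xC.
  move: xX; rewrite opp_row_mx add_row_mx mxl1_row_mx => xX.
  exists (lsubmx x), (rsubmx x), (usubmx C), (dsubmx C); split.
  + by apply: le_trans xX; rewrite lerDl mxl1_ge0.
  + by apply: le_trans xX; rewrite lerDr mxl1_ge0.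
  + by rewrite -mul_row_col.
(* The first term keeps the part of [T1] that [U] kills, so [T1' *m U = u *m corner_mx t1]. *)
pose T1' := T1 *m (1%:M - U *m V) + u *m corner_mx t1 *m V.
pose T2' := u *m corner_mx t2 *m v.
exists (row_mx T2' T1' : 'M_(1, 1 + d)); split.
  have -> : mxl1 (row_mx T2' T1' - T) = mxl1 (T2' - T2) + mxl1 (T1' - T1).
    by rewrite TE -mxl1_row_mx -add_row_mx -opp_row_mx.
  have -> : T2' - T2 = u *m corner_mx (t2 - Z) *m v.
    rewrite corner_mxB ZE mulmxBr mulmxBl !mulmxA uv mul1mx.
    by rewrite -[T2 *m u *m v]mulmxA uv mulmx1.
  have -> : T1' - T1 = u *m corner_mx (t1 - Y) *m V.
    rewrite corner_mxB YE mulmxBr mulmxBl !mulmxA uv mul1mx /T1' mulmxBr mulmx1.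
    by rewrite mulmxA [LHS]addrC !addrA addNr add0r addrC.
  apply: le_trans (_ : mxl1 u * (e / c) * mxl1 v + mxl1 u * (e / c) * mxl1 V <= _).
    apply: lerD; apply: le_trans (ler_mxl1M _ _) _; apply: ler_wpM2r; rewrite ?mxl1_ge0//;
      apply: le_trans (ler_mxl1M _ _) _; apply: ler_wpM2l; rewrite ?mxl1_ge0// mxl1_corner_mx//.
  have -> : mxl1 u * (e / c) * mxl1 v + mxl1 u * (e / c) * mxl1 V =
      e / c * (c - 1) by rewrite [c - 1]addrK; ring.
  rewrite -[leRHS](divfK (lt0r_neq0 c0)); apply: ler_wpM2l.
    by rewrite divr_ge0 ?ltW.
  by rewrite gerBl ler01.
exists (col_mx (u *m corner_mx C2 *m v) (U *m corner_mx C1 *m v) : 'M_(1 + d, 1)).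
have -> : row_mx T2' T1' *m col_mx (u *m corner_mx C2 *m v) (U *m corner_mx C1 *m v) =
  u *m corner_mx (t1 *m C1 + t2 *m C2) *m v.
  have T1U : T1' *m U = u *m corner_mx t1.
    rewrite mulmxDl -[T1 *m _ *m U]mulmxA mulmxBl mul1mx -[U *m V *m U]mulmxA VU Up subrr mulmx0 add0r.
    by rewrite -mulmxA VU -mulmxA mul_corner_mx_scalar.
  have T2u : T2' *m u = u *m corner_mx t2.
    by rewrite -mulmxA -EE -mulmxA -corner_mxM t2E.
  rewrite mul_row_col !mulmxA T1U T2u corner_mxD !corner_mxM mulmxDr mulmxDl.
  by rewrite addrC !mulmxA.
by rewrite tC EE !mulmxA uv mul1mx.
Qed.

End CornerMatrices.

(** * Partial matrix units and ranks *)

Section MatrixUnits.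
Variables (K : numFieldType) (A : banachAlgType K) (n : nat).
Variable M : partial_matrix_units A n.

Let P1 := pmu_P M 1.
Let u i := if i == 1%N then P1 else pmu_U M i.
Let v i := if i == 1%N then P1 else pmu_V M i.

Lemma pmu_geq2 i : (1 <= i <= n)%N -> i != 1%N -> (2 <= i <= n)%N.
Proof. by case: i => [|[|i]]. Qed.

Let PuP i : (1 <= i <= n)%N -> pmu_P M i * u i * P1 = u i.
Proof.
move=> hi; rewrite /u; case: eqVneq => [->|i1]; first by rewrite /P1 !pmu_idem1.
by rewrite -pmu_UE// pmu_geq2.
Qed.

Let PvP i : (1 <= i <= n)%N -> P1 * v i * pmu_P M i = v i.
Proof.
move=> hi; rewrite /v; case: eqVneq => [->|i1]; first by rewrite /P1 !pmu_idem1.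
by rewrite -pmu_VE// pmu_geq2.
Qed.

Let uvP i : (1 <= i <= n)%N -> u i * v i = pmu_P M i.
Proof.
move=> hi; rewrite /u /v; case: eqVneq => [->|i1]; first exact: pmu_idem1.
by rewrite pmu_UV// pmu_geq2.
Qed.

(** Entry [j] holds unit [j.+1], with [pmu_P M 1] serving as both first units. *)
Definition pmu_row m : 'rV[A]_m :=
  \row_(j < m) if j == 0 :> nat then pmu_P M 1 else pmu_U M j.+1.
Definition pmu_col m : 'cV[A]_m :=
  \col_(j < m) if j == 0 :> nat then pmu_P M 1 else pmu_V M j.+1.

Lemma pmu_row_col : pmu_row n *m pmu_col n = 1%:M.
Proof.
apply/matrixP => i j; rewrite !ord1 !mxE -[RHS](pmu_sum M) big_add1 big_mkord.
by apply: eq_bigr => k _; rewrite !mxE -(uvP (i := k.+1)) //= ltn_ord.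
Qed.

Lemma pmu_row_P1 m : (m <= n)%N -> pmu_row m *m (pmu_P M 1)%:M = pmu_row m.
Proof.
move=> mn; apply/matrixP => i j; rewrite mxE (bigD1 j)//= big1 => [|k kj].
  rewrite !mxE eqxx addr0 -/(u j.+1) -[in LHS]PuP -/P1 ?(leq_trans (ltn_ord j) mn) //.
  by rewrite -mulrA /P1 pmu_idem1 PuP ?(leq_trans (ltn_ord j) mn).
by rewrite [_%:M _ _]mxE (negPf kj) mulr0.
Qed.

Lemma P1_pmu_col m : (m <= n)%N -> (pmu_P M 1)%:M *m pmu_col m = pmu_col m.
Proof.
move=> mn; apply/matrixP => i j; rewrite mxE (bigD1 i)//= big1 => [|k ki].
  rewrite !mxE eqxx addr0 -/(v i.+1) -[in LHS]PvP -/P1 ?(leq_trans (ltn_ord i) mn) //.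
  by rewrite !mulrA /P1 pmu_idem1 PvP ?(leq_trans (ltn_ord i) mn).
by rewrite mxE eq_sym (negPf ki) mul0r.
Qed.

(** Off the diagonal, orthogonality of the [P_i] kills [V_i U_j]; on it stands [E_i]. *)
Lemma pmu_col_row m : (m <= n)%N ->
  (forall i, (1 <= i <= m)%N -> pmu_E M i = pmu_P M 1) ->
  pmu_col m *m pmu_row m = (pmu_P M 1)%:M.
Proof.
move=> mn E1; apply/matrixP => i j.
rewrite mxE big_ord1 !mxE -/(v i.+1) -/(u j.+1) -val_eqE /=.
have [<-|ij] := eqVneq (i : nat) j.
  rewrite -[RHS](E1 i.+1) ?ltn_ord// /pmu_E /u /v.
  by case: ifP => // _; rewrite /P1 pmu_idem1.
have hi : (1 <= i.+1 <= n)%N by rewrite (leq_trans (ltn_ord i) mn).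
have hj : (1 <= j.+1 <= n)%N by rewrite (leq_trans (ltn_ord j) mn).
by rewrite -(PvP hi) -(PuP hj) -!mulrA [pmu_P M i.+1 * _]mulrA pmu_orth// !mul0r !mulr0.
Qed.

End MatrixUnits.

(** * Stable ranks and ceilings as comparisons of natural numbers *)

Section Rank.
Variables (K : numFieldType) (B : banachAlgType K).

(** A finite rank is written [k.+1] so that the rank minus one is the natural number [k]. *)
Variant rtsr_spec : \bar rat -> Prop :=
| RtsrFinite k of rtsr_bound B k.+1
    & (forall l, rtsr_bound B l.+1 -> (k <= l)%N) : rtsr_spec k.+1%:R%:E
| RtsrInfinite of (forall k, ~ rtsr_bound B k.+1) : rtsr_spec +oo%E.

Lemma rtsrP : rtsr_spec (rtsr B).
Proof.
rewrite /rtsr; case: pselect => [ex|nex].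
  case: ex_minnP => -[|k] /asboolP[// _ Bk] kmin; apply: RtsrFinite => // l Bl.
  by rewrite -ltnS kmin//; apply/asboolP.
by apply: RtsrInfinite => k Bk; apply: nex; exists k.+1; apply/asboolP.
Qed.

End Rank.

(** The ceiling of [k / m] is the least [d] with [k <= d * m]; this equivalence is all that the
    theorem needs of it. *)
Lemma eceil_natr_divP (k m : nat) : (0 < m)%N ->
  exists2 d0 : nat, (eceil ((k.+1%:R%:E - 1) / m%:R%:E) + 1 = d0.+1%:R%:E)%E
    & forall d, (d0 <= d)%N = (k <= d * m)%N.
Proof.
move=> m0; have m0' : 0 < m%:R :> rat by rewrite ltr0n.
have ceil0 : 0 <= Num.ceil (k%:R / m%:R : rat).
  by rewrite ceil_ge0 (@lt_le_trans _ _ 0)// divr_ge0// ler0n.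
exists `|Num.ceil (k%:R / m%:R : rat)|%N => [|d].
  rewrite inver gt_eqF// -EFinB -EFinM /= -EFinD -!natr1 addrK.
  by rewrite -{1}(gez0_abs ceil0).
by rewrite -lez_nat gez0_abs// ceil_le_int ler_pdivrMr// -pmulrn -natrM ler_nat.
Qed.

Theorem theorem8p2 (K : archiNumFieldType) (A : banachAlgType K) (n : nat)
    (M : partial_matrix_units A n) :
  let A1 := pmu_corner M in
  [/\ (rtsr A1 <= (rtsr A - 1) * n%:R%:E + 1)%E,
      (eceil ((rtsr A1 - 1) / n%:R%:E) + 1 <= rtsr A)%E
    & forall m : nat, (1 <= m <= n)%N ->
        (forall i : nat, (1 <= i <= m)%N -> pmu_E M i = pmu_P M 1) ->
        completely_finite A1 ->
        (rtsr A <= eceil ((rtsr A1 - 1) / m%:R%:E) + 1)%E].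
Proof.
move=> A1.
have n0 : (0 < n)%N by exact: pmu_size M.
have lower d : rtsr_bound A d.+1 -> rtsr_bound A1 (d * n).+1.
  apply: rtsr_bound_corner; first exact: pmu_row_col.
    exact: pmu_row_P1.
  exact: P1_pmu_col.
split.
- case: (rtsrP A) => [d Ad _|_]; last first.
    by rewrite addye// gt0_mulye ?lte_fin ?ltr0n// addye// leey.
  (* An infinite rank of [A1] would contradict [lower]. *)
  case: (rtsrP A1) => [k _ kmin|/(_ (d * n)%N)]; last by move/(_ (lower _ Ad)).
  rewrite -EFinB -EFinM -EFinD lee_fin -!natr1 addrK lerD2r -natrM ler_nat.
  exact/kmin/lower.
- case: (rtsrP A) => [d Ad _|_]; last by rewrite leey.
  case: (rtsrP A1) => [k _ kmin|/(_ (d * n)%N)]; last by move/(_ (lower _ Ad)).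
  have [d0 -> d0P] := eceil_natr_divP k n0.
  by rewrite lee_fin ler_nat ltnS d0P; exact/kmin/lower.
- move=> m /andP[m0 mn] E1 cf.
  case: (rtsrP A1) => [k A1k _|_]; last first.
    rewrite addye// gt0_mulye ?leey// inver.
    by rewrite pnatr_eq0 gtn_eqF// lte_fin invr_gt0 ltr0n.
  have [d -> dP] := eceil_natr_divP k m0.
  have Ad : rtsr_bound A d.+1.
    apply: (@rtsr_bound_of_corner _ _ _ (pmu_idem1 M) (pmu_P1_neq0 M) n
      (pmu_row M n) (pmu_col M n) _ _ _ m (pmu_row M m) (pmu_col M m)) => //.
    + exact: pmu_row_col.
    + exact: pmu_row_P1.
    + exact: P1_pmu_col.
    + exact: pmu_row_P1.
    + exact: P1_pmu_col.
    + exact: pmu_col_row.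
    (* [dP] at [d] itself gives [k <= d * m]. *)
    + by apply: rtsr_bound_leq A1k; rewrite ltnS -dP.
  case: (rtsrP A) => [l _ lmin|/(_ d)//].
  by rewrite lee_fin ler_nat ltnS lmin.
Qed.
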